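(* For any paired symmetric (elasticity) tensor $\mathscr{A}\in\mathbb{T}_{6,3}$, the polynomial $\mathscr{A}x^2y^2z^2$ is a sum of squares of trilinear forms if and only if an unfolded matrix of some semi-paired symmetric tensor of $\mathscr{A}$ is positive semidefinite.
   Context: $\mathbb{T}_{6,3}$ is the set of real tensors $\mathscr{A}=(a_{ijklpq})$ with $i,j,k,l,p,q\in\{1,2,3\}$. $\mathscr{A}$ is paired symmetric if $a_{ijklpq}=a_{jiklpq}=a_{ijlkpq}=a_{ijklqp}$ for all indices; a paired symmetric tensor is an elasticity tensor if moreover $a_{ijklpq}=a_{klijpq}=a_{ijpqkl}$ for all indices. ''Paired symmetric (elasticity) tensor'' means that the statement is made for paired symmetric tensors and likewise for elasticity tensors. For $x,y,z\in\mathbb{R}^3$, $\mathscr{A}x^2y^2z^2:=\sum_{i,j,k,l,p,q=1}^3a_{ijklpq}x_ix_jy_ky_lz_pz_q$; it is a sum of squares of trilinear forms if it equals $\sum_{s=1}^r\big(\sum_{i,k,p=1}^3\alpha^s_{ikp}x_iy_kz_p\big)^2$ identically for some $r\ge1$ and real $\alpha^s_{ikp}$. A tensor $\mathscr{B}=(b_{ijklpq})\in\mathbb{T}_{6,3}$ is a semi-paired symmetric tensor of the paired symmetric tensor $\mathscr{A}$ if for all indices $b_{ijklpq}=b_{jilkqp}$, $b_{jiklpq}=b_{ijlkqp}$, $b_{ijlkpq}=b_{jiklqp}$, $b_{ijklqp}=b_{jilkpq}$ and $b_{ijklpq}+b_{jiklpq}+b_{ijlkpq}+b_{ijklqp}=4a_{ijklpq}$.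 An unfolded matrix of $\mathscr{B}$ is a $27\times27$ matrix with $(s,t)$ entry $b_{i_si_tj_sj_tk_sk_t}$ for $s,t\in\{1,\ldots,27\}$, where $i_1\cdots i_{27}$, $j_1\cdots j_{27}$ and $k_1\cdots k_{27}$ are three arbitrary permutations of $123123\cdots123$ (sequences of length 27 in which each of $1,2,3$ occurs nine times).
   Formalization: The three permutations defining an unfolded matrix are also required to give 27 pairwise distinct triples (i_s,j_s,k_s); with arbitrary permutations the ''if'' direction fails, e.g. a_{111122}=-1, other entries 0, with three equal sequences. *)

(* Defs.v *)
From HB Require Import structures.
From mathcomp Require Import all_boot all_order all_algebra reals.
Set Implicit Arguments.
Unset Strict Implicit.
Unset Printing Implicit Defensive.
Import Order.TTheory GRing.Theory Num.Theory.
Local Open Scope ring_scope.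

(* The index values 1, 2, 3 are the elements 0, 1, 2 of 'I_3. *)
Definition tensor63 (R : Type) : Type :=
  'I_3 -> 'I_3 -> 'I_3 -> 'I_3 -> 'I_3 -> 'I_3 -> R.

Definition paired_symmetric (R : realType) (a : tensor63 R) : Prop :=
  forall i j k l p q : 'I_3,
    [/\ a i j k l p q = a j i k l p q,
        a i j k l p q = a i j l k p q
      & a i j k l p q = a i j k l q p].

Definition elasticity (R : realType) (a : tensor63 R) : Prop :=
  paired_symmetric a /\
  forall i j k l p q : 'I_3,
    a i j k l p q = a k l i j p q /\ a i j k l p q = a i j p q k l.

Definition tensor_form (R : realType) (a : tensor63 R) (x y z : 'rV[R]_3) : R :=
  \sum_(i < 3) \sum_(j < 3) \sum_(k < 3) \sum_(l < 3) \sum_(p < 3) \sum_(q < 3)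
    a i j k l p q * x 0 i * x 0 j * y 0 k * y 0 l * z 0 p * z 0 q.

Definition trilinear_form (R : realType) (alpha : 'I_3 -> 'I_3 -> 'I_3 -> R)
    (x y z : 'rV[R]_3) : R :=
  \sum_(i < 3) \sum_(k < 3) \sum_(p < 3) alpha i k p * x 0 i * y 0 k * z 0 p.

Definition sos_trilinear (R : realType) (a : tensor63 R) : Prop :=
  exists r : nat, (0 < r)%N /\
  exists alpha : 'I_r -> 'I_3 -> 'I_3 -> 'I_3 -> R,
    forall x y z : 'rV[R]_3,
      tensor_form a x y z = \sum_(s < r) trilinear_form (alpha s) x y z ^+ 2.

Definition semi_paired_symmetric_of (R : realType) (a b : tensor63 R) : Prop :=
  forall i j k l p q : 'I_3,
    [/\ b i j k l p q = b j i l k q p,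
        b j i k l p q = b i j l k q p,
        b i j l k p q = b j i k l q p,
        b i j k l q p = b j i l k p q
      & b i j k l p q + b j i k l p q + b i j l k p q + b i j k l q p
        = 4 * a i j k l p q].

(* The sequence 123123...123 of length 27. *)
Definition word123 : seq 'I_3 := flatten (nseq 9 (enum 'I_3)).

(* The index sequences of an unfolding.  Besides each of u, v, w being a
   permutation of 123...123, the triples (u_s, v_s, w_s) are pairwise distinct,
   hence run over all 27 triples: this is what makes the 27 x 27 matrix an
   unfolding, containing each of the 3^6 = 27^2 entries of the tensor exactly
   once.  Without it one could take u = v = w and see only the entries
   b_{ijijij}. *)
Definition unfolding_indices (u v w : 27.-tuple 'I_3) : Prop :=
  [/\ perm_eq u word123, perm_eq v word123, perm_eq w word123
    & injective (fun s : 'I_27 => (tnth u s, tnth v s, tnth w s))].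

Definition unfolded_mx (R : realType) (b : tensor63 R)
    (u v w : 27.-tuple 'I_3) : 'M[R]_27 :=
  \matrix_(s < 27, t < 27)
    b (tnth u s) (tnth u t) (tnth v s) (tnth v t) (tnth w s) (tnth w t).

Definition unfolded_matrix_of (R : realType) (b : tensor63 R)
    (M : 'M[R]_27) : Prop :=
  exists u v w : 27.-tuple 'I_3,
    unfolding_indices u v w /\ M = unfolded_mx b u v w.

Definition psdmx (R : realType) (n : nat) (M : 'M[R]_n) : Prop :=
  M \is symmetricmx /\ forall v : 'cV[R]_n, 0 <= (v^T *m M *m v) 0 0.

(* Main.v *)
(** Contracting a square of a trilinear form gives a tensor
    [c_{ijklpq} = sum_s alpha^s_{ikp} alpha^s_{jlq}], which is a Gram matrix when
    its indices are read as the pair of triples [(i,k,p)], [(j,l,q)].  Averaging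
    [c] over the swaps inside the three pairs yields a paired symmetric tensor
    with the same form, and a paired symmetric tensor is determined by its form
    by polarization in x, y and z.  Conversely a positive semidefinite matrix is
    a Gram matrix, and each of its factors is the coefficient array of a
    trilinear form. *)

Require Import Defs.
From HB Require Import structures.
From mathcomp Require Import all_boot all_order all_algebra reals ring lra zify.
Set Implicit Arguments.
Unset Strict Implicit.
Unset Printing Implicit Defensive.
Import Order.TTheory GRing.Theory Num.Theory.
Local Open Scope ring_scope.

(** * Quadratic forms on a finite index set: polarization and Gram factors *)

Section QuadraticForms.

Variables (R : realType) (I : finType).
Implicit Types (m : I -> I -> R) (v : I -> R).

Definition quad m v : R := \sum_i \sum_j m i j * v i * v j.

Lemma eq_quad m m' v :
  (forall i j, m i j = m' i j) -> quad m v = quad m' v.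
Proof. by move=> e; do 2 (apply: eq_bigr => ? _); rewrite e. Qed.

Lemma quad_gram (J : finType) (w : J -> I -> R) v :
  quad (fun i j => \sum_s w s i * w s j) v = \sum_s (\sum_i w s i * v i) ^+ 2.
Proof.
rewrite /quad; under eq_bigr do under eq_bigr do rewrite 2!mulr_suml.
under eq_bigr do rewrite exchange_big /=.
rewrite exchange_big; apply: eq_bigr => s _ /=.
rewrite expr2 mulr_suml; apply: eq_bigr => i _.
by rewrite mulr_sumr; apply: eq_bigr => j _; ring.
Qed.

Lemma sum_delta (F : I -> R) k : \sum_i F i * (i == k)%:R = F k.
Proof.
rewrite (bigD1 k) //= eqxx mulr1 big1 ?addr0 // => i /negbTE ->.
by rewrite mulr0.
Qed.

(** Moving along one coordinate axis serves twice: it evaluates [quad m] on combinations of two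
    coordinate vectors, for polarization, and it completes the square in [psd_gram]. *)
Lemma quad_shift m v k t : (forall i j, m i j = m j i) ->
  quad m (fun i => v i + t * (i == k)%:R)
  = quad m v + 2 * t * (\sum_i m i k * v i) + t ^+ 2 * m k k.
Proof.
move=> sym; rewrite /quad.
pose L := \sum_i m i k * v i; rewrite -/L.
(* The deltas in [j] are already summed out here; those in [i] are collected into one factor, ready
   for [sum_delta]. *)
have -> : \sum_i \sum_j m i j * (v i + t * (i == k)%:R) * (v j + t * (j == k)%:R)
   = \sum_i (\sum_j m i j * v i * v j + t * (m i k * v i)
       + ((\sum_j m i j * v j) * t + t ^+ 2 * m i k) * (i == k)%:R).
  apply: eq_bigr => i _.
  rewrite -{1}(sum_delta (fun j => m i j * v i) k) -(sum_delta (m i) k).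
  rewrite mulr_suml !mulr_sumr -big_split /= -big_split /= mulr_suml -big_split.
  by apply: eq_bigr => j _ /=; ring.
rewrite !big_split /= sum_delta -mulr_sumr -/L.
have -> : \sum_j m k j * v j = L by apply: eq_bigr => j _; rewrite sym.
by ring.
Qed.

Lemma quad_delta m k : quad m (fun i => (i == k)%:R) = m k k.
Proof. by rewrite /quad; under eq_bigr do rewrite sum_delta; rewrite sum_delta. Qed.

Lemma quad_delta2 m i j t : (forall i j, m i j = m j i) ->
  quad m (fun l => (l == i)%:R + t * (l == j)%:R)
  = m i i + 2 * t * m i j + t ^+ 2 * m j j.
Proof. by move=> sym; rewrite quad_shift // quad_delta sum_delta. Qed.

(** Polarization: the values at e_i + e_j and e_i - e_j differ by [4 * m i j]. *)
Lemma quad_eq0 m : (forall i j, m i j = m j i) -> (forall v, quad m v = 0) ->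
  forall i j, m i j = 0.
Proof.
move=> sym m0 i j.
have := quad_delta2 i j 1 sym; have := quad_delta2 i j (-1) sym.
by rewrite !m0; lra.
Qed.

(* Symmetric elimination: subtracting the rank one matrix
   [m i k * m j k / m k k] keeps [m] positive semidefinite and kills its k-th
   diagonal entry, so the number of nonzero diagonal entries decreases. *)
Lemma psd_gram m : (forall i j, m i j = m j i) -> (forall v, 0 <= quad m v) ->
  exists W : seq (I -> R), forall i j, m i j = \sum_(w <- W) w i * w j.
Proof.
have [n] := ubnP #|[pred i | m i i != 0]|; elim: n m => // n IHn m cardm sym psd.
have diag_ge0 i : 0 <= m i i by rewrite -quad_delta.
case: (pickP [pred i | m i i != 0]) => /= [k mk0 | diag0]; last first.
  (* With a zero diagonal, the values at e_i + e_j and e_i - e_j are opposite, namely [2 * m i j]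
     and its negative; both are nonnegative, so [m] vanishes. *)
  exists [::] => i j; rewrite big_nil.
  have := psd (fun l => (l == i)%:R + 1 * (l == j)%:R).
  have := psd (fun l => (l == i)%:R + (-1) * (l == j)%:R).
  rewrite !quad_delta2 //.
  by rewrite (eqP (negbFE (diag0 i))) (eqP (negbFE (diag0 j))); lra.
have mk_gt0 : 0 < m k k by rewrite lt_def mk0 diag_ge0.
pose m' i j := m i j - m i k * m j k / m k k.
have quadE v : quad m' v = quad m v - (\sum_i m i k * v i) ^+ 2 / m k k.
  rewrite /quad expr2 mulr_suml mulr_suml -sumrB; apply: eq_bigr => i _.
  rewrite mulr_sumr mulr_suml -sumrB; apply: eq_bigr => j _.
  by rewrite /m'; ring.
have sym' i j : m' i j = m' j i by rewrite /m' sym [m j k * _]mulrC.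
have psd' v : 0 <= quad m' v.
  (* This shift minimizes [quad m] on the line through [v] in direction e_k, and the minimum is
     [quad m' v]. *)
  have := psd (fun i => v i + (- (\sum_i m i k * v i) / m k k) * (i == k)%:R).
  rewrite quad_shift // quadE; set L := \sum_i _.
  by congr (_ <= _); field.
have diag_ge0' i : 0 <= m' i i by rewrite -quad_delta.
have [] := IHn m' _ sym' psd'.
  rewrite ltnS in cardm; apply: (leq_trans _ cardm).
  apply: proper_card; apply/properP; split.
    (* A zero diagonal entry stays zero: it becomes minus a square over [m k k], yet it is
       nonnegative. *)
    apply/subsetP => i; rewrite !inE; apply: contraNN => /eqP mi0.
    have := diag_ge0' i; rewrite /m' mi0 sub0r oppr_ge0 -expr2 => le0.
    have ge0 : 0 <= m i k ^+ 2 / m k k by rewrite divr_ge0 ?sqr_ge0.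
    by rewrite oppr_eq0 eq_le le0.
  exists k; rewrite !inE //.
  by rewrite negbK /m' mulfK // subrr.
move=> W mW; exists ((fun i => m i k / Num.sqrt (m k k)) :: W) => i j.
rewrite big_cons -mW /m' mulrACA -invfM -expr2 sqr_sqrtr ?ltW //.
by rewrite addrC subrK.
Qed.

End QuadraticForms.

Lemma quadmxE (R : realType) n (M : 'M[R]_n) (v : 'cV[R]_n) :
  (v^T *m M *m v) 0 0 = quad (fun i j => M i j) (fun i => v i 0).
Proof.
rewrite mxE /quad exchange_big; apply: eq_bigr => j _; rewrite mxE mulr_suml.
by apply: eq_bigr => i _; rewrite mxE [v i 0 * _]mulrC.
Qed.

Lemma symmetricmxP (R : realType) n (M : 'M[R]_n) :
  M \is symmetricmx <-> forall i j, M i j = M j i.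
Proof.
split=> [/is_hermitianmxP symM i j | symM].
  by rewrite {1}symM expr0 scale1r !mxE.
by apply/is_hermitianmxP/matrixP => i j; rewrite expr0 scale1r !mxE symM.
Qed.

(** * The form of a tensor, its polarization, and Gram tensors *)

Section TensorForm.

Variable R : realType.
Implicit Types (a b c : tensor63 R) (x y z : 'rV[R]_3).

(** When [b] is invariant under swapping all three pairs at once, these four terms represent all
    eight combinations of swaps, so this is four times the average over them. *)
Definition swap_sum b : tensor63 R := fun i j k l p q =>
  b i j k l p q + b j i k l p q + b i j l k p q + b i j k l q p.

Lemma tensor_formD a b x y z :
  tensor_form (fun i j k l p q => a i j k l p q + b i j k l p q) x y z
  = tensor_form a x y z + tensor_form b x y z.
Proof.
rewrite /tensor_form; do 6 (rewrite -big_split; apply: eq_bigr => ? _ /=).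
by ring.
Qed.

Lemma tensor_formZ t a x y z :
  tensor_form (fun i j k l p q => t * a i j k l p q) x y z
  = t * tensor_form a x y z.
Proof.
rewrite /tensor_form; do 6 (rewrite mulr_sumr; apply: eq_bigr => ? _ /=).
by ring.
Qed.

(** Each swap only renames two summation indices attached to the same vector. *)
Lemma tensor_form_swap_sum b x y z :
  tensor_form (swap_sum b) x y z = 4 * tensor_form b x y z.
Proof.
rewrite /swap_sum !tensor_formD.
have -> : tensor_form (fun i j k l p q => b j i k l p q) x y z
          = tensor_form b x y z.
  rewrite /tensor_form exchange_big /=.
  by do 6 (apply: eq_bigr => ? _ /=); ring.
have -> : tensor_form (fun i j k l p q => b i j l k p q) x y z
          = tensor_form b x y z.
  rewrite /tensor_form; do 2 (apply: eq_bigr => ? _ /=); rewrite exchange_big /=.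
  by do 4 (apply: eq_bigr => ? _ /=); ring.
have -> : tensor_form (fun i j k l p q => b i j k l q p) x y z
          = tensor_form b x y z.
  rewrite /tensor_form; do 4 (apply: eq_bigr => ? _ /=); rewrite exchange_big /=.
  by do 2 (apply: eq_bigr => ? _ /=); ring.
by ring.
Qed.

(** The nesting lets polarization act on one vector at a time. *)
Lemma tensor_form_quad a x y z :
  tensor_form a x y z
  = quad (fun i j => quad (fun k l => quad (fun p q => a i j k l p q)
        (fun p => z 0 p)) (fun k => y 0 k)) (fun i => x 0 i).
Proof.
rewrite /tensor_form /quad; do 2 (apply: eq_bigr => ? _ /=).
rewrite -mulrA mulr_suml; apply: eq_bigr => ? _.
rewrite mulr_suml; apply: eq_bigr => ? _.
rewrite -mulrA !mulr_suml; apply: eq_bigr => ? _.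
by rewrite !mulr_suml; apply: eq_bigr => ? _; ring.
Qed.

Lemma quad_row (m : 'I_3 -> 'I_3 -> R) v :
  quad m (fun i => (\row_i v i) 0 i : R) = quad m v.
Proof.
by rewrite /quad; do 2 (apply: eq_bigr => ? _); rewrite !mxE.
Qed.

(** Polarization is applied once per vector; each use takes its symmetry hypothesis from one pair of
    indices. *)
Lemma tensor_form_eq0 a : paired_symmetric a ->
  (forall x y z, tensor_form a x y z = 0) -> forall i j k l p q, a i j k l p q = 0.
Proof.
move=> sym a0 i j k l p q.
apply: (quad_eq0 (m := a i j k l)) => [r s | z]; first by case: (sym i j k l r s).
apply: (quad_eq0 (m := fun k l => quad (a i j k l) z)) => [r s | y].
  by apply: eq_quad => p' q'; case: (sym i j r s p' q').
apply: (quad_eq0 (m := fun i j => quad (fun k l => quad (a i j k l) z) y)).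
  move=> r s; apply: eq_quad => k' l'; apply: eq_quad => p' q'.
  by case: (sym r s k' l' p' q').
move=> x; rewrite -[RHS](a0 (\row_i x i) (\row_i y i) (\row_i z i)).
rewrite tensor_form_quad quad_row; apply: eq_quad => *.
by rewrite quad_row; apply: eq_quad => *; rewrite quad_row.
Qed.

Lemma trilinear_form_triple alpha x y z :
  trilinear_form alpha x y z = \sum_(t : 'I_3 * 'I_3 * 'I_3)
    alpha t.1.1 t.1.2 t.2 * (x 0 t.1.1 * y 0 t.1.2 * z 0 t.2).
Proof.
rewrite /trilinear_form pair_bigA pair_bigA.
by apply: eq_bigr => t _ /=; ring.
Qed.

(** The form is thus the quadratic form of a matrix indexed by triples, evaluated at the
    decomposable tensor of [x], [y] and [z]. *)
Lemma tensor_form_triple b x y z :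
  tensor_form b x y z
  = quad (fun s t : 'I_3 * 'I_3 * 'I_3 => b s.1.1 t.1.1 s.1.2 t.1.2 s.2 t.2)
      (fun t => x 0 t.1.1 * y 0 t.1.2 * z 0 t.2).
Proof.
rewrite /quad /tensor_form.
transitivity (\sum_i \sum_k \sum_p \sum_j \sum_l \sum_q
    b i j k l p q * x 0 i * x 0 j * y 0 k * y 0 l * z 0 p * z 0 q).
  apply: eq_bigr => i _; rewrite exchange_big; apply: eq_bigr => k _ /=.
  under eq_bigr do rewrite exchange_big /=.
  by rewrite exchange_big.
rewrite pair_bigA pair_bigA; apply: eq_bigr => s _ /=.
by rewrite pair_bigA pair_bigA; apply: eq_bigr => t _ /=; ring.
Qed.

Lemma tensor_form_gram (J : finType) (alpha : J -> 'I_3 -> 'I_3 -> 'I_3 -> R) x y z :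
  tensor_form (fun i j k l p q => \sum_s alpha s i k p * alpha s j l q) x y z
  = \sum_s trilinear_form (alpha s) x y z ^+ 2.
Proof.
under [RHS]eq_bigr do rewrite trilinear_form_triple.
rewrite tensor_form_triple.
exact: (quad_gram (fun s t => alpha s t.1.1 t.1.2 t.2)).
Qed.

Lemma tensor_form_semi_paired a b :
  semi_paired_symmetric_of a b ->
  forall x y z, tensor_form a x y z = tensor_form b x y z.
Proof.
move=> ab x y z; apply: (@mulfI _ 4%:R); first by rewrite pnatr_eq0.
rewrite -tensor_formZ -tensor_form_swap_sum.
apply: eq_bigr => i _; apply: eq_bigr => j _; apply: eq_bigr => k _.
apply: eq_bigr => l _; apply: eq_bigr => p _; apply: eq_bigr => q _.
by case: (ab i j k l p q) => _ _ _ _ <-.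
Qed.

(** The defect [d] in the averaging condition is paired symmetric and has zero form, hence
    vanishes. *)
Lemma semi_paired_of_form a b : paired_symmetric a ->
  (forall i j k l p q, b i j k l p q = b j i l k q p) ->
  (forall x y z, tensor_form a x y z = tensor_form b x y z) ->
  semi_paired_symmetric_of a b.
Proof.
move=> syma symb ab.
pose d : tensor63 R := fun i j k l p q =>
  4 * a i j k l p q + (-1) * swap_sum b i j k l p q.
(* Swapping one pair permutes the four terms of [swap_sum b], up to the simultaneous swap [symb]. *)
have symd : paired_symmetric d.
  move=> i j k l p q; have [a1 a2 a3] := syma i j k l p q.
  rewrite /d /swap_sum; split.
  - rewrite -a1 (symb j i l k p q) (symb j i k l q p); ring.
  - rewrite -a2 (symb j i l k p q) (symb i j l k q p); ring.
  - rewrite -a3 (symb j i k l q p) (symb i j l k q p); ring.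
have d0 x y z : tensor_form d x y z = 0.
  rewrite /d tensor_formD !tensor_formZ tensor_form_swap_sum ab; ring.
move=> i j k l p q; split; [exact: symb..|].
by move: (tensor_form_eq0 symd d0 i j k l p q); rewrite /d /swap_sum; lra.
Qed.

End TensorForm.

(** * Unfoldings and the equivalence *)

Lemma exists_unfolding_indices : exists u v w, unfolding_indices u v w.
Proof.
pose tup (f : nat -> nat) := [tuple (inord (f s) : 'I_3) | s < 27].
have tupE f : (forall s, f s < 3)%N -> map val (tup f) = map f (iota 0 27).
  move=> f3; rewrite -val_enum_ord -!map_comp; apply: eq_map => s /=.
  by rewrite inordK.
have wordE : map val word123 = flatten (nseq 9 (iota 0 3)).
  by rewrite /word123 map_flatten map_nseq val_enum_ord.
(* Passing from ordinals to numbers leaves a closed condition that computation decides. *)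
have permE f : (forall s, f s < 3)%N ->
    perm_eq (map f (iota 0 27)) (flatten (nseq 9 (iota 0 3))) ->
    perm_eq (tup f) word123.
  by move=> f3 pf; apply: (perm_map_inj val_inj); rewrite tupE // wordE.
(* These are the base 3 digits of [s]: for [s < 27] each digit takes every value nine times, and
   together they determine [s]. *)
pose f1 s := ((s %/ 9) %% 3)%N; pose f2 s := ((s %/ 3) %% 3)%N.
pose f3 s := (s %% 3)%N.
have [b1 b2 b3] : [/\ forall s, (f1 s < 3)%N, forall s, (f2 s < 3)%N
    & forall s, (f3 s < 3)%N].
  by split=> s; rewrite ltn_pmod.
exists (tup f1), (tup f2), (tup f3); split; try exact: permE.
move=> s t; rewrite !tnth_mktuple => -[] /(congr1 val) + /(congr1 val) + /(congr1 val).
rewrite /= !inordK // /f1 /f2 /f3 => e1 e2 e3.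
by apply: val_inj => /=; have := ltn_ord s; have := ltn_ord t; lia.
Qed.

(** There are 27 triples, so the injective map from positions to triples is a bijection; its inverse
    turns each Gram factor of the matrix into trilinear coefficients. *)
Lemma sos_of_psd_unfolding (R : realType) (b : tensor63 R) (M : 'M[R]_27) :
  unfolded_matrix_of b M -> psdmx M -> sos_trilinear b.
Proof.
move=> [u [v [w [[_ _ _ inj] ->]]]] [/symmetricmxP symM psdM].
set phi := (fun s => _) in inj.
have [psi phiK psiK] : bijective phi.
  by apply: inj_card_bij => //; rewrite !card_prod !card_ord.
pose m (s t : 'I_27) : R := unfolded_mx b u v w s t.
have [||W mW] := psd_gram (m := m).
- by move=> s t; exact: symM.
- move=> f; have := psdM (\col_s f s); rewrite quadmxE; congr (_ <= _).
  by do 2 (apply: eq_bigr => ? _); rewrite /m !mxE.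
(* The added zero factor keeps the number of squares positive even if [W] is empty. *)
pose W0 := (fun=> 0) :: W.
exists (size W0); split=> //.
pose alpha (s : 'I_(size W0)) i k p := nth (fun=> 0) W0 s (psi (i, k, p)).
exists alpha => x y z; rewrite -tensor_form_gram.
apply: eq_bigr => i _; apply: eq_bigr => j _; apply: eq_bigr => k _.
apply: eq_bigr => l _; apply: eq_bigr => p _; apply: eq_bigr => q _.
do 6 congr (_ * _).
transitivity (m (psi (i, k, p)) (psi (j, l, q))).
  rewrite /m mxE; have := psiK (i, k, p); have := psiK (j, l, q).
  by rewrite /phi => -[-> -> ->] [-> -> ->].
by rewrite mW /alpha -(big_mkord xpredT (fun s => nth _ W0 s _ * nth _ W0 s _))
  -(big_nth _ xpredT (fun w => w _ * w _)) big_cons mulr0 add0r.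
Qed.

Lemma sos_iff_psd_unfolding (R : realType) (a : tensor63 R) :
  paired_symmetric a ->
  (sos_trilinear a <->
   exists b : tensor63 R, semi_paired_symmetric_of a b /\
     exists M : 'M[R]_27, unfolded_matrix_of b M /\ psdmx M).
Proof.
move=> syma; split=> [[r [_ [alpha aE]]] | [b [ab [M [bM psdM]]]]]; last first.
  have [r [r_gt0 [alpha bE]]] := sos_of_psd_unfolding bM psdM.
  exists r; split=> //; exists alpha => x y z.
  by rewrite (tensor_form_semi_paired ab).
pose b : tensor63 R := fun i j k l p q => \sum_s alpha s i k p * alpha s j l q.
have symb i j k l p q : b i j k l p q = b j i l k q p.
  by apply: eq_bigr => s _; rewrite mulrC.
exists b; split.
  by apply: semi_paired_of_form => // x y z; rewrite tensor_form_gram.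
have [u [v [w uvw]]] := exists_unfolding_indices.
exists (unfolded_mx b u v w); split; first by exists u, v, w.
split; first by apply/symmetricmxP => s t; rewrite !mxE symb.
move=> f; rewrite quadmxE.
(* Every unfolding of [b] is a Gram matrix with factors [g s], so any choice of [u], [v], [w]
   works. *)
pose g s t := alpha s (tnth u t) (tnth v t) (tnth w t).
rewrite (eq_quad _ (m' := fun t t' => \sum_s g s t * g s t')) => [|t t'].
  by rewrite quad_gram sumr_ge0 // => s _; rewrite sqr_ge0.
by rewrite mxE.
Qed.

Theorem theorem5p17 (R : realType) (a : tensor63 R) :
  (paired_symmetric a ->
     (sos_trilinear a <->
      exists b : tensor63 R, semi_paired_symmetric_of a b /\
        exists M : 'M[R]_27, unfolded_matrix_of b M /\ psdmx M))
  /\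
  (elasticity a ->
     (sos_trilinear a <->
      exists b : tensor63 R, semi_paired_symmetric_of a b /\
        exists M : 'M[R]_27, unfolded_matrix_of b M /\ psdmx M)).
Proof.
split=> [|[]]; first exact: sos_iff_psd_unfolding.
by move=> /sos_iff_psd_unfolding.
Qed.
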